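(* For any input domain $V$ (with $|V|\ge2$), the protocol $\Pi_{\mathrm{atc}}^{V}$ (the asynchronous Turpin–Coan extension, defined in the context) securely implements multi-valued asynchronous Byzantine agreement from A-Cast and binary asynchronous Byzantine agreement, in constant rounds and in the presence of an adaptive and malicious $t$-adversary, provided $t<n/5$.
   Context: **Setting.** $n$ parties $p_1,\dots,p_n$ in an asynchronous network with eventual delivery: the adversary schedules messages and may delay each by an arbitrary finite amount, and corrupts up to $t$ parties, adaptively, who may behave arbitrarily. **A-Cast** (ideal primitive): a distinguished sender distributes a value; if one honest party accepts a value from the sender's A-Cast then all honest parties eventually accept the same value; if the sender is honest, all honest parties eventually accept the sender's input. (With a corrupted sender, possibly no honest party ever accepts.) **Asynchronous Byzantine agreement (A-BA)** on a domain $V$: each party has an input in $V$; *agreement*: all honest parties that output, output the same value; *validity*: if all honest parties have the same input $v$, they output $v$. ''Binary'' means $V=\{0,1\}$. ''Securely implements'' means that, with A-Cast and binary A-BA treated as ideal primitives, the agreement and validity properties hold on $V$; termination guarantees are those inherited from the underlying binary A-BA. Round complexity is also counted treating these primitives as ideal. **Protocol $\Pi_{\mathrm{atc}}^{V}$**, $|V|\ge2$ (code for $p_i$ with input $v_i\in V$): 0. Initialize arrays $v[1..n]$ and $x[1..n]$ with the default value $\bot$. 1. A-Cast $v_i$. 2. Whenever $v'_j$ is accepted from $p_j$, record $v[j]:=v'_j$. 3. Wait until $n-t$ values are accepted. Then let $x_i:=1$ (''perplexed'') if $v[j]\ne\bot$ and $v[j]\neq v_i$ for at least $t+1$ different indices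 $j$, and otherwise $x_i:=0$ (''content''). A-Cast $(v_i,x_i)$. 4. Whenever $(v'_j,x'_j)$ is accepted from $p_j$, record $x[j]:=x'_j$; if $v[j]=\bot$, additionally record $v[j]:=v'_j$. 5. Wait until $n-t$ pairs are accepted. Then let $a_i:=1$ (''alert'') if $x[j]=1$ for at least $t+1$ different indices $j$, and otherwise $a_i:=0$. Run binary A-BA with input $a_i$. 6. If the binary A-BA agrees on $1$, set $v$ to a predefined default value from $V$. Otherwise, if content set $v:=v_i$, and if perplexed set $v$ to the majority value among the non-$\bot$ entries $v[j]$ at indices $j$ with $x[j]=0$. Output $v$. *)

(* Defs.v *)
From HB Require Import structures.
From mathcomp Require Import all_boot all_order all_algebra.

Set Implicit Arguments.
Unset Strict Implicit.
Unset Printing Implicit Defensive.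

(** * The ideal primitives

   Time is the index [k] of a global state of the system.  [honest i] means
   that [i] is never corrupted in the execution under consideration.  An input
   [input k i : option T] is what [i] has handed to the primitive by state [k];
   [accepted k i j m] / [returned k i y] say that by state [k] party [i] has
   accepted [m] from the A-Cast of [j] / has obtained the output [y]. *)

Record acast (n : nat) (T : Type) (honest : 'I_n -> Prop)
    (input : nat -> 'I_n -> option T)
    (accepted : nat -> 'I_n -> 'I_n -> T -> Prop) : Prop := Acast {
  acast_unique : forall k i j m m', honest i ->
    accepted k i j m -> accepted k i j m' -> m = m';
  acast_causal : forall k i j m, honest i -> honest j ->
    accepted k i j m -> input k j = Some m;
  acast_consistent : forall k i i' j m, honest i -> honest i' ->
    accepted k i j m -> exists k', accepted k' i' j m;
  acast_correct : forall k i j m, honest i -> honest j ->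
    input k j = Some m -> exists k', accepted k' i j m }.

Definition aba_agreement (n : nat) (T : Type) (honest : 'I_n -> Prop)
    (returned : nat -> 'I_n -> T -> Prop) : Prop :=
  forall k k' i i' y y', honest i -> honest i' ->
    returned k i y -> returned k' i' y' -> y = y'.

Definition aba_validity (n : nat) (T : Type) (honest : 'I_n -> Prop)
    (input : nat -> 'I_n -> option T)
    (returned : nat -> 'I_n -> T -> Prop) : Prop :=
  forall v, (forall i, honest i -> exists k, input k i = Some v) ->
    forall k i y, honest i -> returned k i y -> y = v.

(** [aba] deliberately contains no termination requirement. *)
Record aba (n : nat) (T : Type) (honest : 'I_n -> Prop)
    (input : nat -> 'I_n -> option T)
    (returned : nat -> 'I_n -> T -> Prop) : Prop := Aba {
  aba_causal : forall k i y, honest i -> returned k i y -> input k i <> None;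
  aba_agree : aba_agreement honest returned;
  aba_valid : aba_validity honest input returned }.

(** * The protocol

   [Value j v] is the acceptance of [v] from the first A-Cast of [j],
   [Pair j v x] the acceptance of [(v, x)] from its second A-Cast, and
   [Decision b] the output of the binary A-BA. *)

Inductive message (V : Type) (n : nat) : Type :=
| Value of 'I_n & V
| Pair of 'I_n & V & bool
| Decision of bool.
Arguments Decision {V n} _.

(** [heard] is the set of senders whose first A-Cast has been accepted; it can
   differ from the set of non-default entries of [vals], since these may also
   be filled from pairs.  [perplexed] is x_i and [alert] is a_i; they are
   [None] until the corresponding wait is over. *)
Record local (V : eqType) (n : nat) : Type := Local {
  vals : 'I_n -> option V;
  flags : 'I_n -> option bool;
  heard : {set 'I_n};
  perplexed : option bool;
  alert : option bool;
  output : option V }.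

Definition init (V : eqType) (n : nat) : local V n :=
  Local (fun=> None) (fun=> None) set0 None None None.

(** The strict majority value of [s]; the fallback [d] is arbitrary. *)
Definition majority (V : eqType) (d : V) (s : seq V) : V :=
  head d [seq w <- s | size s < 2 * count_mem w s].

Definition update (n : nat) (T : Type) (f : 'I_n -> T) (j : 'I_n) (y : T) :
    'I_n -> T :=
  fun j' => if j' == j then y else f j'.

Section Protocol.
Variables (V : eqType) (n t : nat) (dflt : V).
Implicit Types (v : V) (s : local V n).

Definition receive v (m : message V n) s : local V n :=
  let: Local vs xs h p a o := s in
  match m with
  | Value j w => Local (update vs j (Some w)) xs (j |: h) p a o
  | Pair j w x =>
      Local (if vs j is None then update vs j (Some w) else vs)
            (update xs j (Some x)) h p a o
  | Decision b =>
      let candidates :=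
        pmap vs [seq j <- enum 'I_n | xs j == Some false] in
      let y := if b then dflt
               else if p == Some true then majority dflt candidates
               else v in
      Local vs xs h p a (if o is None then Some y else o)
  end.

Definition set_perplexed v s : local V n :=
  let: Local vs xs h p a o := s in
  if (p == None) && (n - t <= #|h|) then
    let differing := [set j | (vs j != None) && (vs j != Some v)] in
    Local vs xs h (Some (t.+1 <= #|differing|)) a o
  else s.

Definition set_alert s : local V n :=
  let: Local vs xs h p a o := s in
  if [&& p != None, a == None & n - t <= #|[set j | xs j != None]|] then
    Local vs xs h p (Some (t.+1 <= #|[set j | xs j == Some true]|)) o
  else s.

(** A party with input [v] that obtains [m] updates its state and then runs its
   code until it blocks again. *)
Definition handle v (m : message V n) s : local V n :=
  set_alert (set_perplexed v (receive v m s)).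

End Protocol.

(** * Executions

   At step [k] the adversary may deliver one message to one party
   ([schedule k = Some (i, m)]) and may corrupt further parties; this leads
   from state [k] to state [k.+1]. *)
Record execution (V : eqType) (n : nat) : Type := Execution {
  inputs : 'I_n -> V;
  corrupted : nat -> {set 'I_n};
  schedule : nat -> option ('I_n * message V n);
  state : nat -> 'I_n -> local V n }.

Section Executions.
Variables (V : eqType) (n t : nat) (dflt : V) (e : execution V n).

Definition honest (i : 'I_n) : Prop := forall k, i \notin corrupted e k.

Definition delivered (k : nat) (i : 'I_n) (m : message V n) : Prop :=
  exists2 l, l < k & schedule e l = Some (i, m).

Definition party_input (k : nat) (i : 'I_n) : option V := Some (inputs e i).
Definition value_accepted (k : nat) (i j : 'I_n) (v : V) : Prop :=
  delivered k i (Value j v).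

Definition pair_input (k : nat) (i : 'I_n) : option (V * bool) :=
  omap (pair (inputs e i)) (perplexed (state e k i)).
Definition pair_accepted (k : nat) (i j : 'I_n) (vx : V * bool) : Prop :=
  delivered k i (Pair j vx.1 vx.2).

Definition bit_input (k : nat) (i : 'I_n) : option bool :=
  alert (state e k i).
Definition bit_returned (k : nat) (i : 'I_n) (b : bool) : Prop :=
  delivered k i (Decision b).

Definition party_output (k : nat) (i : 'I_n) (v : V) : Prop :=
  output (state e k i) = Some v.

(** The adversary is adaptive: [corrupted] grows during the execution.  A
   party runs the code as long as it is not corrupted; from then on its state,
   and whatever others accept from it within the limits of the primitives, is
   unconstrained.  Eventual delivery is part of [acast]. *)
Record atc_execution : Prop := AtcExecution {
  corrupted_mono : forall k, corrupted e k \subset corrupted e k.+1;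
  corrupted_bound : forall k, #|corrupted e k| <= t;
  start : forall i, i \notin corrupted e 0 -> state e 0 i = init V n;
  step : forall k i, i \notin corrupted e k.+1 ->
    state e k.+1 i =
      match schedule e k with
      | Some (r, m) =>
          if r == i then handle t dflt (inputs e i) m (state e k i)
          else state e k i
      | None => state e k i
      end;
  value_acast : acast honest party_input value_accepted;
  pair_acast : acast honest pair_input pair_accepted;
  binary_aba : aba honest bit_input bit_returned }.

(** Termination is inherited pathwise: every honest party reaches the binary
   A-BA, and it outputs as soon as the binary A-BA returns to it. *)
Definition inherits_termination : Prop :=
  (forall i, honest i -> exists k b, bit_input k i = Some b) /\
  (forall k i b, honest i -> bit_returned k i b ->
     exists v, party_output k i v).

(** Asynchronous round complexity: [clock k] is the (virtual) time at which
   state [k] is reached.  One unit of time bounds the delay of an A-Cast with an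
   honest sender, and of the binary A-BA once all honest parties have joined
   it; nothing is assumed about the delays of corrupted senders. *)
Record unit_delays (R : realFieldType) (clock : nat -> R) : Prop := UnitDelays {
  clock0 : clock 0 = 0%R;
  clock_mono : forall k, (clock k <= clock k.+1)%R;
  value_delay : forall k i j v, honest i -> honest j ->
    party_input k j = Some v ->
    exists2 k', (clock k' <= clock k + 1)%R & value_accepted k' i j v;
  pair_delay : forall k i j vx, honest i -> honest j ->
    pair_input k j = Some vx ->
    exists2 k', (clock k' <= clock k + 1)%R & pair_accepted k' i j vx;
  bit_delay : forall k,
    (forall i, honest i -> bit_input k i != None) ->
    forall i, honest i ->
    exists2 k', (clock k' <= clock k + 1)%R & exists b, bit_returned k' i b }.

Definition done_within (R : realFieldType) (clock : nat -> R) (c : nat) : Prop :=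
  forall i, honest i ->
    exists2 k, (clock k <= c%:R)%R & exists v, party_output k i v.

End Executions.

(** Quantifying over all executions covers every adaptive adversary, whatever
   the randomness used by it or by the binary A-BA. *)
Definition securely_implements_aba (V : eqType) (n t : nat) (dflt : V) : Prop :=
  forall e : execution V n, atc_execution t dflt e ->
    [/\ aba_agreement (honest e) (party_output e),
        aba_validity (honest e) (party_input e) (party_output e)
      & inherits_termination e].

Definition runs_in_rounds (V : eqType) (n t : nat) (dflt : V) (c : nat) : Prop :=
  forall (e : execution V n) (R : realFieldType) (clock : nat -> R),
    atc_execution t dflt e -> unit_delays e clock -> done_within e clock c.

(* Main.v *)
(** If v is the input of a content honest party, then at least n - 2t - c honest
   parties have input v, where c <= t is the number of corrupted parties; two
   such values would need 2(n - 2t - c) <= n - c, that is n <= 4t + c <= 5t.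
   Hence content honest parties share one input.  If the binary A-BA returns 0,
   some honest party is not alert: it accepted at most t perplexed flags among
   n - t, so by consistency of the A-Cast every honest party sees at least
   n - 3t > 2t content flags; at most t of them come from corrupted parties, and
   so the common input of the content honest parties has a strict majority.
   With unanimous honest inputs nobody honest is perplexed or alert.  The two
   A-Casts and the binary A-BA take one unit of time each. *)

Require Import Defs.
From mathcomp Require Import all_boot all_order all_algebra zify.
From Stdlib Require Import Classical.

Set Implicit Arguments.
Unset Strict Implicit.
Unset Printing Implicit Defensive.

(** * Counting, strict majorities and bounds over finite sets *)

Lemma count_pmap (T S : Type) (a : pred S) (f : T -> option S) (s : seq T) :
  count a (pmap f s) = count (fun x => oapp a false (f x)) s.
Proof. by elim: s => //= x s <-; case: (f x). Qed.

Lemma size_filter_enum (T : finType) (a : pred T) :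
  size [seq x <- enum T | a x] = #|[set x | a x]|.
Proof.
rewrite cardsE cardE /enum_mem -filter_predI; congr size.
by apply: eq_filter => x /=; rewrite inE /= andbT.
Qed.

(** Two distinct values cannot both fill more than half of [s], since their counts add up to at most
    [size s]. So the head of the filtered list is [v], and the fallback [d] is never reached. *)
Lemma majority_eq (V : eqType) (d v : V) (s : seq V) :
  size s < 2 * count_mem v s -> majority d s = v.
Proof.
move=> maj; rewrite /majority; set l := filter _ s.
have vl : v \in l.
  by rewrite mem_filter maj -has_pred1 has_count; lia.
have: head d l \in l by case: (l) vl => [|w l'] _ //=; rewrite mem_head.
rewrite mem_filter => /andP[maj' _]; apply/eqP; apply/negPn/negP => neq.
have := count_predUI (pred1 (head d l)) (pred1 v) s.
have -> : count (predI (pred1 (head d l)) (pred1 v)) s = 0.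
  rewrite -(count_pred0 s); apply: eq_count => w /=.
  by apply/negbTE/negP => /andP[/eqP -> /eqP E]; rewrite E eqxx in neq.
have := count_size (predU (pred1 (head d l)) (pred1 v)) s.
by lia.
Qed.

(** Merges the separate waiting times of finitely many parties into a single state. [P] is kept
    abstract so that it can carry a clock bound or nothing at all. *)
Lemma uniform_bound (n : nat) (H : {set 'I_n}) (P : nat -> Prop)
    (Q : 'I_n -> nat -> Prop) :
  P 0 -> (forall k k', P k -> P k' -> P (maxn k k')) ->
  (forall j k k', k <= k' -> Q j k -> Q j k') ->
  (forall j, j \in H -> exists2 k, P k & Q j k) ->
  exists2 k, P k & forall j, j \in H -> Q j k.
Proof.
move=> P0 Pmax Qmono PQ.
suff [k Pk Qk] : exists2 k, P k & forall j, j \in enum H -> Q j k.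
  by exists k => // j jH; apply: Qk; rewrite mem_enum.
have: {subset enum H <= H} by move=> j; rewrite mem_enum.
elim: (enum H) => [_|j s IH sub]; first by exists 0.
have [|k Pk Qk] := IH; first by move=> j' j's; apply: sub; rewrite inE j's orbT.
have [k' Pk' Qk'] := PQ j (sub _ (mem_head _ _)).
exists (maxn k k'); first exact: Pmax.
move=> j'; rewrite inE => /predU1P[->|j's].
  exact: Qmono (leq_maxr _ _) Qk'.
exact: Qmono (leq_maxl _ _) (Qk _ j's).
Qed.

(** If no [A K] contained all the others, strict growth would recur and the cardinalities would
    exceed [#|T|]. The index [K] is obtained classically, because no state announces that corruption
    is over. *)
Lemma mono_sets_stable (T : finType) (A : nat -> {set T}) :
  (forall k, A k \subset A k.+1) -> exists K, forall k, A k \subset A K.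
Proof.
move=> mono.
have monoL k k' : k <= k' -> A k \subset A k'.
  elim: k' => [|k' IH]; first by rewrite leqn0 => /eqP->.
  by rewrite leq_eqVlt ltnS => /predU1P[->//|/IH/subset_trans]; apply.
apply: NNPP => nK.
have big m : exists k, m <= #|A k|.
  elim: m => [|m [k mk]]; first by exists 0.
  have [k' k'k] := not_all_ex_not _ _ (not_ex_all_not _ _ nK k).
  exists (maxn k k'); apply: leq_ltn_trans mk (proper_card _).
  rewrite properE (monoL _ _ (leq_maxl _ _)); apply/negP => sub.
  by apply: k'k; apply: subset_trans (monoL _ _ (leq_maxr _ _)) sub.
by have [k] := big #|T|.+1; rewrite ltnNge max_card.
Qed.

Lemma card_cover3 (T : finType) (X A B C : {set T}) :
  X \subset A :|: B :|: C -> #|X| <= #|A| + #|B| + #|C|.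
Proof.
move=> /subset_leq_card sub; apply: leq_trans sub _.
apply: leq_trans (leq_card_setU _ _).1 _.
by rewrite leq_add2r (leq_card_setU _ _).1.
Qed.

(** * Effect of one message on a local state *)

Section Handle.
Variables (V : eqType) (n t : nat) (dflt : V).
Implicit Types (v : V) (s : local V n) (m : message V n).

(** This and the next four definitions name the sets and the output rule that stand inline in the
    protocol code. *)
Definition differing v s : {set 'I_n} :=
  [set j | (vals s j != None) && (vals s j != Some v)].
Definition flagged s : {set 'I_n} := [set j | flags s j != None].
Definition claiming s (x : bool) : {set 'I_n} := [set j | flags s j == Some x].
Definition candidates s :=
  pmap (vals s) [seq j <- enum 'I_n | flags s j == Some false].
Definition decide v s (b : bool) : V :=
  if b then dflt
  else if perplexed s == Some true then majority dflt (candidates s) else v.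

Lemma vals_handle v m s :
  vals (handle t dflt v m s) = vals (receive dflt v m s).
Proof.
rewrite /handle; case: (receive _ _ _ _) => vs xs h p a o /=.
by do 2 case: ifP => //=.
Qed.

Lemma flags_handle v m s :
  flags (handle t dflt v m s) = flags (receive dflt v m s).
Proof.
rewrite /handle; case: (receive _ _ _ _) => vs xs h p a o /=.
by do 2 case: ifP => //=.
Qed.

Lemma heard_handle v m s :
  heard (handle t dflt v m s) = heard (receive dflt v m s).
Proof.
rewrite /handle; case: (receive _ _ _ _) => vs xs h p a o /=.
by do 2 case: ifP => //=.
Qed.

Lemma output_handle v m s :
  output (handle t dflt v m s) = output (receive dflt v m s).
Proof.
rewrite /handle; case: (receive _ _ _ _) => vs xs h p a o /=.
by do 2 case: ifP => //=.
Qed.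

(** The test reads the state after the receipt, but the old flag can be taken before it, since
    [receive] leaves that field alone. *)
Lemma perplexed_handle v m s (s' := handle t dflt v m s) :
  perplexed s' =
    if (perplexed s == None) && (n - t <= #|heard s'|)
    then Some (t < #|differing v s'|) else perplexed s.
Proof.
rewrite /differing {}/s' vals_handle heard_handle /handle.
have -> : perplexed s = perplexed (receive dflt v m s)
  by case: m s => [? ?|? ? ?|?] [].
case: (receive _ _ _ _) => vs xs h p a o /=.
by do 2 case: ifP => //=.
Qed.

Lemma alert_handle v m s (s' := handle t dflt v m s) :
  alert s' =
    if [&& perplexed s' != None, alert s == None & n - t <= #|flagged s'|]
    then Some (t < #|claiming s' true|) else alert s.
Proof.
rewrite /flagged /claiming {}/s' flags_handle /handle.
have -> : alert s = alert (receive dflt v m s)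
  by case: m s => [? ?|? ? ?|?] [].
case: (receive _ _ _ _) => vs xs h p a o /=.
by case: p => [x|] /=; do 2?[case: ifP => _ /= //]; case: ifP.
Qed.

Lemma output_receive v m s :
  output (receive dflt v m s) =
    if m is Decision b then
      if output s is None then Some (decide v s b) else output s
    else output s.
Proof. by case: m s => [? ?|? ? ?|?] []. Qed.

End Handle.

(** * Behaviour of a single honest party along an execution *)

Section Execution.
Variables (V : eqType) (n t : nat) (dflt : V) (e : execution V n).
Hypothesis ex : atc_execution t dflt e.
Hypothesis lt5 : 5 * t < n.

Local Notation st := (state e).

Lemma delivered_mono k k' i m : k <= k' -> delivered e k i m -> delivered e k' i m.
Proof. by move=> kk' [l lk E]; exists l => //; apply: leq_trans kk'. Qed.

Lemma deliveredS k i m :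
  delivered e k.+1 i m <-> delivered e k i m \/ schedule e k = Some (i, m).
Proof.
split=> [[l]|[d|E]]; last by exists k.
- by rewrite ltnS leq_eqVlt => /predU1P[-> ?|lk E]; [right | left; exists l].
- exact: delivered_mono d.
Qed.

(** Indexed by the successor state, so that a case analysis replaces [st k.+1 i] in the goal: either
    nothing is addressed to [i], or [i] handles one message. *)
Variant step_spec k i : local V n -> Prop :=
| Idle of (forall m, schedule e k <> Some (i, m)) : step_spec k i (st k i)
| Receipt m of schedule e k = Some (i, m) :
    step_spec k i (handle t dflt (inputs e i) m (st k i)).

Lemma stateSP k i : honest e i -> step_spec k i (st k.+1 i).
Proof.
move=> hi; rewrite (step ex (hi k.+1)).
case E: (schedule e k) => [[r m]|]; last by apply: Idle => m; rewrite E.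
case: eqP => [ri|ri]; first by apply: Receipt; rewrite E ri.
by apply: Idle => m'; rewrite E => -[].
Qed.

Lemma state0 i : honest e i -> st 0 i = init V n.
Proof. by move=> hi; apply: (start ex). Qed.

Lemma heard_delivered k i j v :
  honest e i -> delivered e k i (Value j v) -> j \in heard (st k i).
Proof.
move=> hi; elim: k => [|k IH] ; first by case.
rewrite deliveredS; case: (stateSP k hi) => [N|m E] [d|E'].
- exact: IH.
- by case: (N _ E').
- rewrite heard_handle; case: m E (st k i) (IH d) => [j' ?|? ? ?|?] _ [] //=.
  by move=> *; rewrite inE; apply/orP; right.
- move: E; rewrite E' heard_handle => -[<-].
  by case: (st k i) => *; rewrite /= setU11.
Qed.

Lemma vals_delivered k i j w : honest e i -> vals (st k i) j = Some w ->
  delivered e k i (Value j w) \/ exists x, delivered e k i (Pair j w x).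
Proof.
move=> hi; elim: k => [|k IH]; first by rewrite state0.
case: (stateSP k hi) => [N|m E].
  by move=> /IH[d|[x d]]; [left | right; exists x]; apply: delivered_mono d.
have {}IH : vals (st k i) j = Some w ->
    delivered e k.+1 i (Value j w) \/ exists x, delivered e k.+1 i (Pair j w x).
  by move=> /IH[d|[x d]]; [left | right; exists x]; apply: delivered_mono d.
rewrite vals_handle.
case: m E (st k i) IH => [j' v|j' v x|b] E [vs xs h p a o] //= IH.
- rewrite /update; case: eqP => // -> [<-].
  by left; apply/deliveredS; right.
- case E': (vs j') => [u|]; first exact: IH.
  rewrite /update; case: eqP => // -> [<-].
  by right; exists x; apply/deliveredS; right.
Qed.

Lemma flags_delivered k i j x : honest e i -> flags (st k i) j = Some x ->
  exists w, delivered e k i (Pair j w x).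
Proof.
move=> hi; elim: k => [|k IH]; first by rewrite state0.
have {}IH : flags (st k i) j = Some x -> exists w, delivered e k.+1 i (Pair j w x).
  by move=> /IH[w d]; exists w; apply: delivered_mono d.
case: (stateSP k hi) => [N|m E] //.
rewrite flags_handle.
case: m E (st k i) IH => [j' v|j' v x'|b] E [vs xs h p a o] //= IH.
rewrite /update; case: eqP => // -> [<-].
by exists v; apply/deliveredS; right.
Qed.

Lemma delivered_flagged k i j w x :
  honest e i -> delivered e k i (Pair j w x) -> j \in flagged (st k i).
Proof.
move=> hi; rewrite inE; elim: k => [|k IH]; first by case.
rewrite deliveredS; case: (stateSP k hi) => [N|m E] [d|E'].
- exact: IH.
- by case: (N _ E').
- rewrite flags_handle; case: m E (st k i) (IH d) => [? ?|j' ? ?|?] _ [] //=.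
  by move=> *; rewrite /update; case: (j =P j').
- move: E; rewrite E' flags_handle => -[<-].
  by case: (st k i) => *; rewrite /= /update eqxx.
Qed.

(** Uniqueness of the second A-Cast rules out that a later pair from [j] overwrites the flag, even
    if [j] is corrupted. *)
Lemma delivered_flags k i j w x :
  honest e i -> delivered e k i (Pair j w x) -> flags (st k i) j = Some x.
Proof.
move=> hi d; have := delivered_flagged hi d; rewrite inE.
case E: (flags _ j) => [x'|] // _; congr Some.
have [w' d'] := flags_delivered hi E.
by have [] := acast_unique (pair_acast ex) (m := (w, x)) (m' := (w', x')) hi d d'.
Qed.

Lemma vals_recorded k i j : honest e i ->
  (j \in heard (st k i)) || (j \in flagged (st k i)) -> vals (st k i) j != None.
Proof.
move=> hi; rewrite inE; elim: k => [|k IH]; first by rewrite state0 //= inE.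
case: (stateSP k hi) => // m _; rewrite heard_handle flags_handle vals_handle.
case: m (st k i) IH => [j' v|j' v x|b] [vs xs h p a o] //= IH.
- by rewrite in_setU1 /update; case: (j == j').
- case E: (vs j') => [u|]; rewrite /update; last by case: (j == j').
  by case: (j =P j') => // ->; rewrite E.
Qed.

(** The wait is tested again after every message, and it is not yet over in the initial state
    because [n - t] is positive. *)
Lemma perplexed_due k i : honest e i ->
  n - t <= #|heard (st k i)| -> perplexed (st k i) != None.
Proof.
move=> hi; elim: k => [|k IH]; first by rewrite state0 //= cards0; lia.
case: (stateSP k hi) => // m _ le; rewrite perplexed_handle le andbT.
by case: (perplexed (st k i)).
Qed.

Lemma perplexed_mono k k' i b : honest e i -> k <= k' ->
  perplexed (st k i) = Some b -> perplexed (st k' i) = Some b.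
Proof.
move=> hi; elim: k' => [|k' IH]; first by rewrite leqn0 => /eqP->.
rewrite leq_eqVlt => /predU1P[->//|lt E]; have {}IH := IH lt E.
by case: (stateSP k' hi) => // m _; rewrite perplexed_handle IH.
Qed.

(** The flag is written once; [l] is the state in which the first wait ends, and the counting
    arguments refer to that state. *)
Lemma perplexedP k i b : honest e i -> perplexed (st k i) = Some b ->
  exists2 l, n - t <= #|heard (st l i)| &
    b = (t < #|differing (inputs e i) (st l i)|).
Proof.
move=> hi; elim: k => [|k IH]; first by rewrite state0.
case Es: (st k.+1 i) / (stateSP k hi) => [//|m E].
rewrite perplexed_handle; case: ifP => // /andP[_ le] [<-].
by exists k.+1; rewrite Es.
Qed.

Lemma flagged_mono k k' i : honest e i -> k <= k' ->
  flagged (st k i) \subset flagged (st k' i).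
Proof.
move=> hi kk'; apply/subsetP => j; rewrite inE.
case E: (flags _ j) => [x|] // _.
have [w d] := flags_delivered hi E.
exact: delivered_flagged hi (delivered_mono kk' d).
Qed.

Lemma alert_due k i : honest e i -> perplexed (st k i) != None ->
  n - t <= #|flagged (st k i)| -> alert (st k i) != None.
Proof.
move=> hi; elim: k => [|k IH]; first by rewrite state0.
case: (stateSP k hi) => // m _ p le; rewrite alert_handle p le andbT.
by case: (alert (st k i)).
Qed.

Lemma alert_mono k k' i b : honest e i -> k <= k' ->
  alert (st k i) = Some b -> alert (st k' i) = Some b.
Proof.
move=> hi; elim: k' => [|k' IH]; first by rewrite leqn0 => /eqP->.
rewrite leq_eqVlt => /predU1P[->//|lt E]; have {}IH := IH lt E.
by case: (stateSP k' hi) => // m _; rewrite alert_handle IH andbF.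
Qed.

Lemma alertP k i b : honest e i -> alert (st k i) = Some b ->
  exists l, [/\ l <= k, perplexed (st l i) != None,
    n - t <= #|flagged (st l i)| & b = (t < #|claiming (st l i) true|)].
Proof.
move=> hi; elim: k => [|k IH]; first by rewrite state0.
have {}IH : alert (st k i) = Some b -> exists l, [/\ l <= k.+1,
    perplexed (st l i) != None, n - t <= #|flagged (st l i)|
    & b = (t < #|claiming (st l i) true|)].
  by move=> /IH[l [lk *]]; exists l; split=> //; apply: leqW.
case Es: (st k.+1 i) / (stateSP k hi) => [//|m E].
rewrite alert_handle; case: ifP => // /and3P[p _ le] [<-].
by exists k.+1; rewrite Es.
Qed.

Lemma alert_ready k i : honest e i -> alert (st k i) != None ->
  perplexed (st k i) != None /\ n - t <= #|flagged (st k i)|.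
Proof.
move=> hi; case E: alert => [b|] // _.
have [l [lk p le _]] := alertP hi E; split.
  by case Ep: (perplexed (st l i)) p => [x|] // _; rewrite (perplexed_mono hi lk Ep).
exact: leq_trans le (subset_leq_card (flagged_mono hi lk)).
Qed.

Lemma output_due k i b : honest e i -> delivered e k i (Decision b) ->
  exists v, party_output e k i v.
Proof.
rewrite /party_output => hi; elim: k => [|k IH]; first by case.
rewrite deliveredS; case: (stateSP k hi) => [N|m E] [d|E'].
- exact: IH.
- by case: (N _ E').
- rewrite output_handle output_receive; have [v ->] := IH d.
  by case: m E => *; exists v.
- move: E; rewrite E' output_handle output_receive => -[<-].
  by case: (output _) => [v|]; [exists v | eexists].
Qed.

Lemma outputP k i y : honest e i -> party_output e k i y ->
  exists l b, [/\ delivered e l i (Decision b), perplexed (st l i) != None,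
    n - t <= #|flagged (st l i)| & y = decide dflt (inputs e i) (st l i) b].
Proof.
rewrite /party_output => hi; elim: k => [|k IH]; first by rewrite state0.
case Es: (st k.+1 i) / (stateSP k hi) => [//|m E].
rewrite output_handle output_receive; case: m E Es => // b E Es.
case: (output _) IH => [//|_ [<-]]; exists k.+1, b.
have d : delivered e k.+1 i (Decision b) by apply/deliveredS; right.
(* By causality the binary A-BA answers only a party that has joined it, so both waits of [i] are
   over. *)
have /eqP a := aba_causal (binary_aba ex) hi d.
have [p le] := alert_ready hi a; split=> //.
(* The output is computed from the state before the step. [Decision] changes neither [vals] nor
   [flags], and [due] excludes that the perplexed flag is set in this very step, so [decide] gives
   the same value afterwards. *)
have due := @perplexed_due k i hi.
rewrite /decide /candidates Es flags_handle vals_handle.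
rewrite perplexed_handle heard_handle.
case: (st k i) due => vs xs h px a0 o /=.
by case: px => [x|] //=; case: (leqP (n - t) #|h|) => // _ /(_ isT).
Qed.

(** Honesty quantifies over all states; once the corrupted sets have stabilised it becomes
    membership in a finite set, which can be counted. *)
Lemma honest_set : exists2 H : {set 'I_n},
  forall i, honest e i <-> i \in H & #|~: H| <= t.
Proof.
have [K sub] := mono_sets_stable (corrupted_mono ex).
exists (~: corrupted e K); last by rewrite setCK (corrupted_bound ex).
move=> i; rewrite inE; split=> [|iK k]; first exact.
by apply: contra iK; apply/subsetP.
Qed.

(** An entry may stem from either A-Cast of [j]; by causality both carry the input of an honest
    [j]. *)
Lemma vals_honest k i j w : honest e i -> honest e j ->
  vals (st k i) j = Some w -> w = inputs e j.
Proof.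
move=> hi hj /(vals_delivered hi)[d|[x d]].
  by have [] := acast_causal (value_acast ex) hi hj d.
have := acast_causal (pair_acast ex) (m := (w, x)) hi hj d.
by rewrite /pair_input; case: perplexed => //= ? [].
Qed.

Lemma flags_honest k i j x : honest e i -> honest e j ->
  flags (st k i) j = Some x -> perplexed (st k j) = Some x.
Proof.
move=> hi hj /(flags_delivered hi)[w d].
have := acast_causal (pair_acast ex) (m := (w, x)) hi hj d.
by rewrite /pair_input; case: perplexed => //= ? [_ ->].
Qed.

(** * Quorum counting for content parties *)

Section HonestSet.
Variable H : {set 'I_n}.
Hypothesis hP : forall i, honest e i <-> i \in H.
Hypothesis Ht : #|~: H| <= t.

Lemma card_honest : n - t <= #|H|.
Proof. by have := cardsC H; rewrite card_ord; lia. Qed.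

(** When the first wait of [i] ends, each of the at least [n - t] heard senders is one of at most
    [t] differing ones, is corrupted, or is honest with the input of [i]. *)
Lemma content_support k i : honest e i -> perplexed (st k i) = Some false ->
  n <= #|[set j in H | inputs e j == inputs e i]| + t + t + #|~: H|.
Proof.
move=> hi /(perplexedP hi)[l le]; set D := differing _ _ => /esym/negbT.
rewrite -leqNgt => Dt; set E := [set j in H | _].
suff /card_cover3 : heard (st l i) \subset D :|: E :|: ~: H by lia.
apply/subsetP => j jh; have vj := vals_recorded hi (introT orP (or_introl jh)).
rewrite !inE vj /=; case: (boolP (j \in H)) => [/hP hj|_]; last by rewrite orbT.
case Ev: (vals _ j) vj => [w|] // _; rewrite (vals_honest hi hj Ev).
by rewrite (inj_eq Some_inj) orbF andTb; case: eqP.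
Qed.

Lemma content_agree k k' i i' : honest e i -> honest e i' ->
  perplexed (st k i) = Some false -> perplexed (st k' i') = Some false ->
  inputs e i = inputs e i'.
Proof.
move=> hi hi' /(content_support hi) + /(content_support hi').
set E := [set j in H | _]; set E' := [set j in H | _] => cE cE'.
apply/eqP/negPn/negP => neq.
have dis : #|E :&: E'| = 0.
  apply/eqP; rewrite cards_eq0 -subset0; apply/subsetP => j; rewrite !inE.
  by case/andP=> /andP[_ /eqP ji] /andP[_]; rewrite ji (negbTE neq).
have /subset_leq_card : E :|: E' \subset H.
  by apply/subsetP => j; rewrite !inE => /orP[] /andP[].
(* With c = [#|~: H|], two disjoint supports in [H] give 2(n - 2t - c) <= n - c, against [lt5]. *)
by have := cardsC H; rewrite card_ord; have := cardsUI E E'; lia.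
Qed.

Lemma content_majority k0 k i0 i : honest e i0 -> honest e i ->
  alert (st k0 i0) = Some false -> n - t <= #|flagged (st k i)| ->
  exists j, [/\ honest e j, perplexed (st k j) = Some false
    & majority dflt (candidates (st k i)) = inputs e j].
Proof.
move=> hi0 hi /(alertP hi0)[l [_ _ leS]].
set T := claiming _ _ => /esym/negbT; rewrite -leqNgt => Tt leS'.
set C := claiming (st k i) false.
have /card_cover3 sub : flagged (st k i) \subset
    C :|: T :|: ~: flagged (st l i0).
  apply/subsetP => j; rewrite !inE; case E: (flags (st k i) j) => [x|] // _.
  case E0: (flags (st l i0) j) => [x0|]; last by rewrite orbT.
  have [w0 d0] := flags_delivered hi0 E0.
  have [k1 d1] := acast_consistent (pair_acast ex) (m := (w0, x0)) hi0 hi d0.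
  have [w d] := flags_delivered hi E.
  (* The sender [j] may be corrupted, so the views of [i0] and [i] are tied only by consistency;
     they are compared at a state of [i] late enough for both deliveries. *)
  have := delivered_flags hi (delivered_mono (leq_maxl k k1) d).
  rewrite (delivered_flags hi (delivered_mono (leq_maxr k k1) d1)) => -[<-].
  by case: (x0).
(* [T] has at most [t] elements and [i0] misses at most [t] pairs, so [C] has at least n - 3t
   elements. *)
have cC : 2 * t < #|C|.
  by have := cardsC (flagged (st l i0)); rewrite card_ord; lia.
have cCH : #|C| < 2 * #|C :&: H|.
  have : #|C :\: H| <= t.
    by rewrite setDE; apply: leq_trans Ht; apply: subset_leq_card; apply: subsetIr.
  by have := cardsID H C; lia.
(* Any honest sender in [C] can serve as witness, since content honest parties share their input. *)
have /card_gt0P[j] : 0 < #|C :&: H| by lia.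
rewrite !inE => /andP[/eqP Cj /hP hj].
exists j; have pj := flags_honest hi hj Cj; split=> //.
apply: majority_eq; rewrite size_pmap count_pmap.
have sz : size [seq j <- enum 'I_n | flags (st k i) j == Some false] = #|C|.
  exact: size_filter_enum.
(* An upper bound on the number of candidates suffices here; that the honest entries are really
   present is needed only for the count of the majority value below. *)
apply: leq_ltn_trans (_ : #|C| < _); first by rewrite -sz count_size.
apply: leq_trans cCH _; rewrite leq_mul2l /= count_filter -size_filter.
rewrite size_filter_enum; apply: subset_leq_card; apply/subsetP => j'.
rewrite !inE => /andP[/eqP Cj' /hP hj']; rewrite Cj' eqxx andbT.
have := @vals_recorded k i j' hi; rewrite !inE Cj' orbT => /(_ isT).
case Ev: vals => [w|] //= _; rewrite (vals_honest hi hj' Ev); apply/eqP.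
exact: content_agree hj' hj (flags_honest hi hj' Cj') pj.
Qed.

(** * Liveness: all honest parties join the binary A-BA *)

(** [P1] and [P2] are the states in the first round and in the first two rounds
   when rounds are counted, and all states when only termination matters. *)
Lemma all_join (P1 P2 : nat -> Prop) :
  P1 0 -> (forall k, P1 k -> P2 k) ->
  (forall k k', P1 k -> P1 k' -> P1 (maxn k k')) ->
  (forall k k', P2 k -> P2 k' -> P2 (maxn k k')) ->
  (forall i j, honest e i -> honest e j ->
     exists2 k, P1 k & value_accepted e k i j (inputs e j)) ->
  (forall k i j vx, P1 k -> honest e i -> honest e j ->
     pair_input e k j = Some vx ->
     exists2 k', P2 k' & pair_accepted e k' i j vx) ->
  exists2 k, P2 k & forall i, honest e i -> bit_input e k i != None.
Proof.
move=> P10 P12 P1max P2max val pair.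
have pstable j k k' : k <= k' -> perplexed (st k j) != None -> honest e j ->
    perplexed (st k' j) != None.
  move=> kk'; case E: (perplexed _) => [x|] // _ hj.
  by rewrite (perplexed_mono hj kk' E).
(* At [k1] every honest party has heard all honest inputs, so it has set its flag and A-Cast its
   pair. *)
have [||k1 P1k1 p1] := @uniform_bound n H P1
  (fun j k => honest e j -> perplexed (st k j) != None) P10 P1max.
- by move=> j k k' kk' p hj; apply: pstable kk' (p hj) hj.
- move=> i /hP hi.
  have [||k Pk vk] := @uniform_bound n H P1
    (fun j k => value_accepted e k i j (inputs e j)) P10 P1max.
  + by move=> j k k'; apply: delivered_mono.
  + by move=> j /hP hj; apply: val.
  exists k => // _; apply: perplexed_due => //.
  apply: leq_trans card_honest (subset_leq_card _).
  by apply/subsetP => j jH; apply: heard_delivered (vk j jH).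
have [||k2 P2k2 p2] := @uniform_bound n H P2
  (fun i k => honest e i -> bit_input e k i != None) (P12 _ P10) P2max.
- move=> i k k' kk' p hi; move: (p hi); rewrite /bit_input.
  by case E: (alert _) => [x|] // _; rewrite (alert_mono hi kk' E).
- move=> i iH; have /hP hi := iH.
  have [||k Pk dk] := @uniform_bound n H P2
    (fun j k => exists vx, pair_accepted e k i j vx) (P12 _ P10) P2max.
  + by move=> j k k' kk' [vx d]; exists vx; apply: delivered_mono d.
  + move=> j jH; have /hP hj := jH; have := p1 j jH hj.
    case E: (perplexed _) => [x|] // _.
    have [|k Pk d] := pair k1 i j (inputs e j, x) P1k1 hi hj.
      by rewrite /pair_input E.
    by exists k => //; exists (inputs e j, x).
  (* The maximum ensures that the first wait of [i] is over as well, as [alert_due] demands. *)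
  exists (maxn k1 k) => [|_]; first exact: P2max (P12 _ P1k1) Pk.
  apply: alert_due => //; first exact: pstable (leq_maxl _ _) (p1 i iH hi) hi.
  apply: leq_trans card_honest (subset_leq_card _).
  apply/subsetP => j jH; have [vx d] := dk j jH.
  exact: delivered_flagged hi (delivered_mono (leq_maxr _ _) d).
by exists k2 => // i hi; apply: p2 => //; apply/hP.
Qed.

Lemma eventually_all_join :
  exists k, forall i, honest e i -> bit_input e k i != None.
Proof.
have [|||||k _ a] := @all_join (fun=> True) (fun=> True) I => //.
- move=> i j hi hj; have [//|k d] := acast_correct (value_acast ex) (k := 0)
    (m := inputs e j) hi hj.
  by exists k.
- move=> k i j vx _ hi hj E.
  by have [k' d] := acast_correct (pair_acast ex) hi hj E; exists k'.
- by exists k.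
Qed.

(** * Agreement, validity, termination and round count *)

Lemma not_alert k i : honest e i -> bit_returned e k i false ->
  exists k0 i0, honest e i0 /\ alert (st k0 i0) = Some false.
Proof.
(* Otherwise every honest party would join with input 1, and validity of the binary A-BA would
   exclude the result 0. *)
move=> hi d; apply: NNPP => none; have [k1 a1] := eventually_all_join.
suff: false = true by [].
apply: (aba_valid (binary_aba ex)) hi d => j hj; exists k1.
move: (a1 j hj); rewrite /bit_input; case E: alert => [[]|] // _.
by case: none; exists k1, j.
Qed.

Lemma atc_agreement : aba_agreement (honest e) (party_output e).
Proof.
move=> k k' i i' y y' hi hi' /(outputP hi)[l [b [d p le ->]]].
move=> /(outputP hi')[l' [b' [d' p' le' ->]]].
have <- := aba_agree (binary_aba ex) hi hi' d d'.
(* On result 1 both outputs are [dflt]. On result 0 each output is traced back to the input of a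
   content honest party. *)
case: b d {d'} => // d; have [k0 [i0 [hi0 a0]]] := not_alert hi d.
have content m j : honest e j -> perplexed (st m j) != None ->
    n - t <= #|flagged (st m j)| -> exists j', [/\ honest e j',
    perplexed (st m j') = Some false
    & decide dflt (inputs e j) (st m j) false = inputs e j'].
  move=> hj pj lej; rewrite /decide.
  case E: (perplexed _) pj => [[]|] // _; last by exists j.
  exact: content_majority hi0 hj a0 lej.
have [j [hj pj ->]] := content l i hi p le.
have [j' [hj' pj' ->]] := content l' i' hi' p' le'.
exact: content_agree hj hj' pj pj'.
Qed.

Lemma atc_validity :
  aba_validity (honest e) (party_input e) (party_output e).
Proof.
move=> v allv k i y hi /(outputP hi)[l [b [d p le ->]]].
have inp j : honest e j -> inputs e j = v by move=> /allv[_ []].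
(* Under unanimity a differing entry can only sit at a corrupted index, so there are at most [t] of
   them; below, the same count bounds the perplexed flags. *)
have content m j x : honest e j -> perplexed (st m j) = Some x -> x = false.
  move=> hj /(perplexedP hj)[l' _ ->]; apply/negbTE; rewrite -leqNgt.
  apply: leq_trans Ht; apply/subset_leq_card/subsetP => j'; rewrite !inE.
  case Ev: vals => [w|] //=; apply: contra => /hP hj'.
  by rewrite (vals_honest hj hj' Ev) !inp.
have [k1 a1] := eventually_all_join.
have -> : b = false.
  apply: (aba_valid (binary_aba ex)) hi d => j hj; exists k1.
  move: (a1 j hj); rewrite /bit_input; case E: alert => [x|] // _.
  have [l' [_ _ _ ->]] := alertP hj E; congr Some; apply/negbTE; rewrite -leqNgt.
  apply: leq_trans Ht; apply/subset_leq_card/subsetP => j'; rewrite !inE.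
  move=> /eqP Ef; apply/negP => /hP hj'.
  by have := content _ _ _ hj' (flags_honest hj hj' Ef).
rewrite /decide; case E: perplexed p => [x|] // _.
by rewrite (content _ _ _ hi E) inp.
Qed.

Lemma atc_termination : inherits_termination e.
Proof.
split=> [i hi|k i b hi]; last exact: output_due.
have [k /(_ i hi)] := eventually_all_join.
by case E: bit_input => [b|] // _; exists k, b.
Qed.

Lemma atc_rounds (R : realFieldType) (clock : nat -> R) :
  unit_delays e clock -> done_within e clock 3.
Proof.
move=> ud i hi.
pose P (c : nat) k := (clock k <= c%:R)%R.
have Pmax c k k' : P c k -> P c k' -> P c (maxn k k').
  by rewrite /P /maxn; case: ifP.
(* One unit of delay leads from time bound [c] to [c.+1]. *)
have P1 k k' c : P c k -> (clock k' <= clock k + 1)%R -> P c.+1 k'.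
  rewrite /P => Pk /Order.POrderTheory.le_trans; apply.
  by rewrite -GRing.natr1 Num.Theory.lerD2r.
have P0 : P 0 0 by rewrite /P (clock0 ud).
have P10 : P 1 0 by apply: P1 P0 _; rewrite Num.Theory.lerDl.
have P12 k : P 1 k -> P 2 k.
  by move=> /Order.POrderTheory.le_trans; apply; rewrite Num.Theory.ler_nat.
have [||k Pk a] := @all_join (P 1) (P 2) P10 P12 (@Pmax 1) (@Pmax 2).
- move=> i' j hi' hj; have [//|k le d] := value_delay ud (k := 0)
    (v := inputs e j) hi' hj.
  by exists k => //; apply: P1 P0 le.
- move=> k i' j vx Pk hi' hj E; have [k' le d] := pair_delay ud hi' hj E.
  by exists k' => //; apply: P1 Pk le.
have [k' le [b d]] := bit_delay ud a hi; exists k'; first exact: P1 Pk le.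
exact: output_due hi d.
Qed.

End HonestSet.

End Execution.

Theorem proposition9 :
  exists c : nat,
    forall (V : eqType) (dflt : V) (n t : nat),
      (exists a b : V, a <> b) ->
      5 * t < n ->
      securely_implements_aba n t dflt /\ runs_in_rounds n t dflt c.
Proof.
(* One unit for each of the two A-Casts and one for the binary A-BA. *)
exists 3 => V dflt n t _ lt5; split=> [e ex|e R clock ex].
  have [H hP Ht] := honest_set ex; split.
  - exact: atc_agreement ex lt5 _ hP Ht.
  - exact: atc_validity ex lt5 _ hP Ht.
  - exact: atc_termination ex lt5 _ hP Ht.
have [H hP Ht] := honest_set ex; exact: atc_rounds ex lt5 _ hP Ht _ _.
Qed.
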